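(* For every integer $b\ge1$ there is a real number $C_b$ such that for all $s\in\mathbb{C}$ with $\Re(s)>C_b$ one has $G_{0,b}(s)=\zeta(s)$ (the series in the recursive definition of $G_{0,b}(s)$ being convergent).
   Context: For complex $s_1,\dots,s_r$, the Euler–Zagier multiple zeta function is $\zeta(s_1,\dots,s_r):=\sum_{1\le n_1<\cdots<n_r} n_1^{-s_1}\cdots n_r^{-s_r}$ (absolutely convergent when $\Re(s_l+\cdots+s_r)>r-l+1$ for all $1\le l\le r$, and meromorphically continued to $\mathbb{C}^r$). For integers $a\ge0$, $b\ge1$ define $G_{a,b}(s_1,\dots,s_a;s)$ inductively on $b$ by $G_{a,1}(s_1,\dots,s_a;s):=\zeta(s_1,\dots,s_a,s)$ and, for $b\ge2$, \[ G_{a,b}(s_1,\dots,s_a;s):=\sum_{n=0}^{\infty}\Bigl(G_{a+1,b-1}(s_1,\dots,s_a,s-n-b;\,n+b)-G_{a+1,b-1}(s_1,\dots,s_a,-n;\,s+n)\Bigr). \] $G_{0,b}(s)$ denotes the case $a=0$. *)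

(* Defs.v *)
From HB Require Import structures.
From mathcomp Require Import all_boot all_order all_algebra.
From mathcomp Require Import complex.
From mathcomp Require Import all_classical all_reals all_analysis.

Set Implicit Arguments.
Unset Strict Implicit.
Unset Printing Implicit Defensive.

Import Order.TTheory GRing.Theory Num.Theory.
Import numFieldNormedType.Exports.

Local Open Scope classical_set_scope.
Local Open Scope ring_scope.

(* The topology of R[i] given by the complex modulus, as for any numFieldType;
   'rV[R[i]]_r then carries the usual topology of C^r. *)
HB.instance Definition _ (R : realType) := NormedModule.copy R[i] (R[i])^o.

Section MultipleZeta.
Variable R : realType.
Implicit Types (r b : nat) (s z : R[i]) (t : seq R[i]).

Definition cexp z : R[i] :=
  (expR (complex.Re z))%:C%C
    * Complex (cos (complex.Im z)) (sin (complex.Im z)).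

(* n ^ (- s) for n >= 1, with the real logarithm of n. *)
Definition natpowN (n : nat) s : R[i] := cexp (- s * (ln (n%:R : R))%:C%C).

(* With 0-based l this reads Re (s_{l+1} + ... + s_r) > r - (l+1) + 1. *)
Definition mzeta_domain r : set 'rV[R[i]]_r :=
  [set s | forall l : 'I_r,
    (r - l)%:R < complex.Re (\sum_(i < r | (l <= i)%N) s ord0 i)].

(* Truncation at N of the multiple series: the sum over
   1 <= n_1 < ... < n_r <= N, where n_i is encoded by n_i - 1 : 'I_N. *)
Definition mzeta_partial r (s : 'rV[R[i]]_r) (N : nat) : R[i] :=
  \sum_(n : r.-tuple 'I_N | sorted ltn [seq val k | k <- n])
    \prod_(i < r) natpowN (tnth n i).+1 (s ord0 i).

(* On mzeta_domain the series converges absolutely, so that its sum is the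
   limit of these truncations. *)
Definition mzeta_series r (s : 'rV[R[i]]_r) : R[i] := limn (mzeta_partial s).

(* z is the value at s of an analytic continuation of the series. The
   complement in C^r of the polar set of the meromorphic continuation is open
   and connected, so its points are exactly those at which there is such a
   value, and this value is the one of the meromorphic continuation. *)
Definition mzeta_continuation r (s : 'rV[R[i]]_r) : set R[i] :=
  [set z | exists (U : set 'rV[R[i]]_r) (F : 'rV[R[i]]_r -> R[i]),
    [/\ open U, connected U, @mzeta_domain r `<=` U & U s] /\
    [/\ forall x : 'rV[R[i]]_r, U x -> differentiable F x,
        forall x : 'rV[R[i]]_r, mzeta_domain x -> F x = mzeta_series x
      & F s = z]].

(* Arbitrarily 0 on the polar set, see mzeta_row_regular. *)
Definition mzeta_row r (s : 'rV[R[i]]_r) : R[i] :=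
  if `[< mzeta_domain s >] then mzeta_series s
  else xget 0 (mzeta_continuation s).

Definition mzeta_row_regular r (s : 'rV[R[i]]_r) : Prop :=
  mzeta_domain s \/ mzeta_continuation s !=set0.

Definition row_of_seq t : 'rV[R[i]]_(size t) := \row_(i < size t) t`_i.

(* zeta(s_1, ..., s_r) for t = [:: s_1; ...; s_r] *)
Definition mzeta t : R[i] := mzeta_row (row_of_seq t).

Definition mzeta_regular t : Prop := mzeta_row_regular (row_of_seq t).

(* G b [:: s_1; ...; s_a] s is G_{a,b}(s_1, ..., s_a; s); the value at b = 0 is
   irrelevant. *)
Fixpoint G b t s : R[i] :=
  match b with
  | 0 => 0
  | b'.+1 =>
    if b' is 0 then mzeta (rcons t s) else
    limn (series (fun n : nat =>
      G b' (rcons t (s - n%:R - b%:R)) (n%:R + b%:R)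
      - G b' (rcons t (- n%:R)) (s + n%:R)))
  end.

(* G b t s is meaningful: all the series in its recursive definition, at every
   level, converge, and no value of zeta is taken at a singularity. *)
Fixpoint G_defined b t s : Prop :=
  match b with
  | 0 => False
  | b'.+1 =>
    if b' is 0 then mzeta_regular (rcons t s) else
    (forall n : nat,
      G_defined b' (rcons t (s - n%:R - b%:R)) (n%:R + b%:R) /\
      G_defined b' (rcons t (- n%:R)) (s + n%:R)) /\
    cvgn (series (fun n : nat =>
      G b' (rcons t (s - n%:R - b%:R)) (n%:R + b%:R)
      - G b' (rcons t (- n%:R)) (s + n%:R)))
  end.

End MultipleZeta.

(* Main.v *)
Require Import Defs.
From mathcomp Require Import all_boot all_order all_algebra.
From mathcomp Require Import complex ring lra zify.
From mathcomp Require Import all_classical all_reals all_analysis.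
Import Order.TTheory GRing.Theory Num.Theory.
Import numFieldNormedType.Exports.
Local Open Scope classical_set_scope.
Local Open Scope ring_scope.

Set Implicit Arguments.
Unset Strict Implicit.
Unset Printing Implicit Defensive.

(** Write h_r(x_1, ..., x_n) for the complete homogeneous symmetric polynomials.
    All the zeta values involved lie in the domain of absolute convergence, and
    by induction on b
      G_{a,b}(s_1, ..., s_a; s) =
        sum_{n_1 < ... < n_a < l} n_1^{-s_1} ... n_a^{-s_a} l^{b-1-s}
          h_{b-1}(1/l, 1/(l-1), ..., 1/(l-n_a)),
    where n_a is read as 0 if a = 0. For a = 0 the right-hand side is
    sum_l l^{b-1-s} l^{1-b} = zeta(s).
    In the induction step the sum over n is geometric; exchanging the remaining
    sums over k = n_{a+1} < l reduces the claim to
      sum_{l > k} h_r(1/l, ..., 1/(l-k)) k / (l (l-k)) = h_{r+1}(1, ..., 1/k),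
    which telescopes because
      (x_k - x_0) h_r(x_0, ..., x_k)
        = h_{r+1}(x_1, ..., x_k) - h_{r+1}(x_0, ..., x_{k-1}).
    The exchanges are dominated since h_r(1, ..., 1/k) = O(sqrt k), while the
    exponents leave a margin of 1. *)

(** * Rearrangement of sums, dominated convergence, and limits of complex sequences *)

Lemma triangle_swap (V : nmodType) (F : nat -> nat -> V) (L : nat) :
  \sum_(l < L) \sum_(k < l) F l k = \sum_(k < L) \sum_(k.+1 <= l < L) F l k.
Proof.
elim: L => [|L IH]; first by rewrite !big_ord0.
rewrite !big_ord_recr /= IH [X in _ = _ + X]big_geq // addr0 -big_split /=.
by apply: eq_bigr => k _; rewrite big_nat_recr.
Qed.

Section SeriesCvg.
Variable R : realType.

Lemma abs_series_cvg (f : nat -> R) (A : R) :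
  (forall N, \sum_(k < N) `|f k| <= A) ->
  exists z : R, (fun N => \sum_(k < N) f k) @ \oo --> z.
Proof.
move=> fA.
have cvf : cvgn [normed series f].
  apply: nondecreasing_is_cvgn.
    by apply: nondecreasing_series => *; exact: normr_ge0.
  by exists A => _ [N _ <-]; rewrite /= seriesEord; exact: fA.
have := normed_cvg cvf; set z := limn _ => cvz.
exists z; rewrite (_ : (fun _ => _) = series f) //.
by rewrite seriesEord.
Qed.

Lemma geometric_cvg (q : R) : 0 <= q < 1 ->
  (fun N => \sum_(n < N) q ^+ n) @ \oo --> (1 - q)^-1.
Proof.
move=> /andP[q0 q1].
have := @cvg_geometric_series R 1 q; rewrite ger0_norm // => /(_ q1).
rewrite seriesEord mul1r; apply: cvg_trans.
by apply: near_eq_cvg; near=> N; apply: eq_bigr => n _; rewrite /= mul1r.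
Unshelve. all: by end_near.
Qed.

Lemma sum_geometric_le (q : R) N : 0 <= q < 1 -> \sum_(n < N) q ^+ n <= (1 - q)^-1.
Proof.
move=> /andP[q0 q1]; have q1' : 0 < 1 - q by rewrite subr_gt0.
rewrite -[leRHS]mul1r ler_pdivlMr //.
have -> : (\sum_(n < N) q ^+ n) * (1 - q) = 1 - q ^+ N.
  by rewrite -[1 - q ^+ N]opprB subrX1; ring.
by rewrite gerBl exprn_ge0.
Qed.

(** Dominated convergence for series. Choose [K] so that the tail of [M] beyond [K] is at most
    [e / 4]: the tails of [g] and of [f n] cost at most [e / 4] each, and the finite head [D n]
    tends to 0 termwise, so the distance is at most [3 e / 4] for large [n]. *)
Lemma tannery (f : nat -> nat -> R) (g M z : nat -> R) (z0 A : R) :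
  (forall N, \sum_(k < N) M k <= A) -> (forall n k, `|f n k| <= M k) ->
  (forall k, (fun n => f n k) @ \oo --> g k) ->
  (forall n, (fun N => \sum_(k < N) f n k) @ \oo --> z n) ->
  (fun N => \sum_(k < N) g k) @ \oo --> z0 ->
  z @ \oo --> z0.
Proof.
move=> MA fM fg fz gz.
have M0 k : 0 <= M k by apply: le_trans (fM 0 k).
have gM k : `|g k| <= M k.
  have h : (fun n => `|f n k|) @ \oo --> `|g k| by apply: cvg_norm.
  by apply: cvgr_to_le h _; near=> n; exact: fM.
have [m Mm] : exists m : R, (fun N => \sum_(k < N) M k) @ \oo --> m.
  apply: (@abs_series_cvg M A) => N.
  by under eq_bigr do rewrite ger0_norm //.
have Mle N : \sum_(k < N) M k <= m.
  apply: cvgr_to_ge Mm _; near=> L.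
  have NL : (N <= L)%N by near: L; exists N.
  rewrite -!(big_mkord xpredT M) (big_cat_nat _ NL) //= lerDl.
  by rewrite sumr_ge0.
apply/cvgrPdist_lt => e e0.
have e4 : 0 < e / 4 by rewrite divr_gt0.
move/cvgrPdist_lt: (Mm) => /(_ _ e4) [K _ /(_ K (leqnn K))] /= HK.
have tail L : (K <= L)%N -> \sum_(K <= k < L) M k <= e / 4.
  move=> KL; have := Mle L; rewrite -(big_mkord xpredT M) (big_cat_nat _ KL) //=.
  rewrite big_mkord => ?; have := ler_norm (m - \sum_(k < K) M k); lra.
pose D n := \sum_(k < K) `|f n k - g k|.
have D0 : D @ \oo --> 0.
  rewrite [X in _ --> X](_ : 0 = \sum_(k < K) (0 : R)); last by rewrite big1.
  apply: cvg_big => [|k _]; first exact: add_continuous.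
  have : (fun n => `|f n k - g k|) @ \oo --> `|g k - g k|.
    by apply: cvg_norm; apply: cvgB => //; exact: cvg_cst.
  by rewrite subrr normr0.
move/cvgrPdist_lt: D0 => /(_ _ e4) HD; near=> n.
have Dn : D n < e / 4.
  have : `|0 - D n| < e / 4 by near: n.
  by rewrite sub0r normrN => /(le_lt_trans (ler_norm _)).
have h : (fun N => `|\sum_(k < N) g k - \sum_(k < N) f n k|) @ \oo --> `|z0 - z n|.
  by apply: cvg_norm; apply: cvgB.
suff : `|z0 - z n| <= e / 4 + (e / 4 + e / 4) by lra.
apply: cvgr_to_le h _; near=> L.
have KL : (K <= L)%N by near: L; exists K.
rewrite -sumrB -(big_mkord xpredT (fun k => g k - f n k)) (big_cat_nat _ KL) //=.
apply: le_trans (ler_normD _ _) _; apply: lerD.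
  rewrite big_mkord; apply: le_trans (ler_norm_sum _ _ _) _.
  by under eq_bigr do rewrite distrC; exact: ltW.
apply: le_trans (ler_norm_sum _ _ _) _.
apply: (@le_trans _ _ (\sum_(K <= k < L) (M k + M k))).
  apply: ler_sum => k _; apply: le_trans (ler_normB _ _) _.
  exact: lerD.
by rewrite big_split /=; apply: lerD; exact: tail.
Unshelve. all: by end_near.
Qed.

(* Componentwise, because [cvgD] and [cvgM] fail to unify on R[i]. *)
Definition ccvg (u : nat -> R[i]) (z : R[i]) : Prop :=
  ((fun n => complex.Re (u n)) @ \oo --> complex.Re z) /\
  ((fun n => complex.Im (u n)) @ \oo --> complex.Im z).

Lemma Re_le_normc (z : R[i]) : `|complex.Re z| <= Normc.normc z.
Proof.
by case: z => a b /=; rewrite -sqrtr_sqr ler_wsqrtr // lerDl sqr_ge0.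
Qed.

Lemma Im_le_normc (z : R[i]) : `|complex.Im z| <= Normc.normc z.
Proof.
by case: z => a b /=; rewrite -sqrtr_sqr ler_wsqrtr // lerDr sqr_ge0.
Qed.

Lemma normc_le_ReIm (z : R[i]) : Normc.normc z <= `|complex.Re z| + `|complex.Im z|.
Proof.
case: z => a b /=; rewrite -[X in _ <= X]ger0_norm ?addr_ge0 // -sqrtr_sqr.
rewrite ler_wsqrtr // sqrrD !real_normK ?num_real // lerD2r lerDl.
by rewrite mulrn_wge0 // mulr_ge0.
Qed.

Lemma normc_nneg (z : R[i]) : 0 <= Normc.normc z.
Proof. by case: z => a b; exact: sqrtr_ge0. Qed.

Lemma normc_real (x : R) : 0 <= x -> Normc.normc x%:C%C = x.
Proof. by move=> x0; rewrite /= expr0n addr0 sqrtr_sqr ger0_norm. Qed.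

Lemma normc_sum (I : Type) (r : seq I) (P : pred I) (F : I -> R[i]) :
  Normc.normc (\sum_(i <- r | P i) F i) <= \sum_(i <- r | P i) Normc.normc (F i).
Proof.
elim/big_ind2: _ => [|x x' y y' h h'|//]; first by rewrite Normc.normc0.
by apply: le_trans (le_normcD _ _) _; exact: lerD.
Qed.

Lemma Re_natr (m : nat) : complex.Re (m%:R : R[i]) = m%:R.
Proof. by rewrite -(rmorph_nat (real_complex R)). Qed.

Lemma ccvg_cvg (u : nat -> R[i]) z : ccvg u z -> u @ \oo --> z.
Proof.
move=> [/cvgrPdist_lt ure /cvgrPdist_lt uim]; apply/cvgrPdist_lt => e e0.
(* A positive element of [R[i]] has zero imaginary part. *)
have [e' e'0 ->] : exists2 e' : R, 0 < e' & e = e'%:C%C.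
  case: e e0 => a b; rewrite ltcE /= => /andP[/eqP -> a0].
  by exists a.
have e2 : 0 < e' / 2 by rewrite divr_gt0.
move: (ure _ e2) (uim _ e2) => {}ure {}uim; near=> n.
rewrite /Num.norm /= ltcR; apply: le_lt_trans (normc_le_ReIm _) _.
rewrite raddfB /=.
have H1 : `|complex.Re z - complex.Re (u n)| < e' / 2 by near: n.
have H2 : `|complex.Im z - complex.Im (u n)| < e' / 2 by near: n.
rewrite raddfB/= [X in _ < X]splitr.
exact: ltrD.
Unshelve. all: by end_near.
Qed.

Lemma ccvg_lim (u : nat -> R[i]) z : ccvg u z -> limn u = z.
Proof. by move/ccvg_cvg => uz; apply: cvg_lim uz; exact: norm_hausdorff. Qed.

Lemma ccvg_unique (u : nat -> R[i]) z z' : ccvg u z -> ccvg u z' -> z = z'.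
Proof. by move=> /ccvg_lim <- /ccvg_lim. Qed.

Lemma ccvgD (u v : nat -> R[i]) z z' :
  ccvg u z -> ccvg v z' -> ccvg (fun n => u n + v n) (z + z').
Proof.
move=> [ure uim] [vre vim]; split.
  rewrite raddfD /=; under eq_fun do rewrite raddfD /=; exact: cvgD.
rewrite raddfD /=; under eq_fun do rewrite raddfD /=; exact: cvgD.
Qed.

Lemma ccvgB (u v : nat -> R[i]) z z' :
  ccvg u z -> ccvg v z' -> ccvg (fun n => u n - v n) (z - z').
Proof.
move=> [ure uim] [vre vim]; split.
  rewrite raddfB /=; under eq_fun do rewrite raddfB /=; exact: cvgB.
rewrite raddfB /=; under eq_fun do rewrite raddfB /=; exact: cvgB.
Qed.

Lemma ccvg_cst z : ccvg (fun=> z) z.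
Proof. by split; exact: cvg_cst. Qed.

Lemma ccvg_sum (I : Type) (r : seq I) (P : pred I) (u : I -> nat -> R[i])
    (z : I -> R[i]) :
  (forall i, P i -> ccvg (u i) (z i)) ->
  ccvg (fun n => \sum_(i <- r | P i) u i n) (\sum_(i <- r | P i) z i).
Proof.
move=> uz; elim: r => [|i r IH].
  by rewrite big_nil; under [X in ccvg X]eq_fun do rewrite big_nil; exact: ccvg_cst.
rewrite big_cons; under [X in ccvg X]eq_fun do rewrite big_cons.
by case: ifP => // Pi; apply: ccvgD => //; exact: uz.
Qed.

Lemma Re_scale (z : R[i]) (a : R) : complex.Re (z * a%:C%C) = complex.Re z * a.
Proof. by case: z => x y /=; rewrite mulr0 subr0. Qed.

Lemma Im_scale (z : R[i]) (a : R) : complex.Im (z * a%:C%C) = complex.Im z * a.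
Proof. by case: z => x y /=; rewrite mulr0 add0r. Qed.

Lemma ccvgZ (c : R[i]) (a : nat -> R) (a0 : R) :
  a @ \oo --> a0 -> ccvg (fun n => c * (a n)%:C%C) (c * a0%:C%C).
Proof.
move=> aa0; split.
  rewrite Re_scale; under eq_fun do rewrite Re_scale.
  by apply: cvgM => //; exact: cvg_cst.
rewrite Im_scale; under eq_fun do rewrite Im_scale.
by apply: cvgM => //; exact: cvg_cst.
Qed.

Lemma ccvg_eventually (f g : nat -> R[i]) z K :
  (forall n, (K <= n)%N -> f n = g n) -> ccvg g z -> ccvg f z.
Proof.
move=> fg [gre gim]; split.
  by apply: cvg_trans gre; apply: near_eq_cvg; exists K => // n /= Kn; rewrite fg.
by apply: cvg_trans gim; apply: near_eq_cvg; exists K => // n /= Kn; rewrite fg.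
Qed.

Lemma abs_cseries_cvg (f : nat -> R[i]) (A : R) :
  (forall N, \sum_(k < N) Normc.normc (f k) <= A) ->
  exists z, ccvg (fun N => \sum_(k < N) f k) z.
Proof.
move=> fA.
have [|x fx] := @abs_series_cvg (fun k => complex.Re (f k)) A.
  by move=> N; apply: le_trans (fA N); apply: ler_sum => k _; exact: Re_le_normc.
have [|y fy] := @abs_series_cvg (fun k => complex.Im (f k)) A.
  by move=> N; apply: le_trans (fA N); apply: ler_sum => k _; exact: Im_le_normc.
exists (Complex x y); split => /=.
  by under eq_fun do rewrite raddf_sum /=.
by under eq_fun do rewrite raddf_sum /=.
Qed.

Lemma ctannery (f : nat -> nat -> R[i]) (g : nat -> R[i]) (M : nat -> R)
    (z : nat -> R[i]) (z0 : R[i]) (A : R) :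
  (forall N, \sum_(k < N) M k <= A) -> (forall n k, Normc.normc (f n k) <= M k) ->
  (forall k, ccvg (fun n => f n k) (g k)) ->
  (forall n, ccvg (fun N => \sum_(k < N) f n k) (z n)) ->
  ccvg (fun N => \sum_(k < N) g k) z0 ->
  ccvg z z0.
Proof.
move=> MA fM fg fz [gre gim]; split.
  apply: (@tannery (fun n k => complex.Re (f n k)) (fun k => complex.Re (g k))
    M _ _ A) => //.
  - by move=> n k; apply: le_trans (fM n k); exact: Re_le_normc.
  - by move=> k; case: (fg k).
  - by move=> n; case: (fz n) => h _; under eq_fun do rewrite -raddf_sum /=.
  - by under eq_fun do rewrite -raddf_sum /=.
apply: (@tannery (fun n k => complex.Im (f n k)) (fun k => complex.Im (g k))
  M _ _ A) => //.
- by move=> n k; apply: le_trans (fM n k); exact: Im_le_normc.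
- by move=> k; case: (fg k).
- by move=> n; case: (fz n) => _ h; under eq_fun do rewrite -raddf_sum /=.
- by under eq_fun do rewrite -raddf_sum /=.
Qed.

End SeriesCvg.

(** * Complete homogeneous polynomials in reciprocals of consecutive integers *)

Section CompleteHomogeneous.
Variable R : realType.

(* [hsym r n l] is the complete homogeneous symmetric polynomial of degree [r]
   in the [n] variables 1/l, 1/(l-1), ..., 1/(l-n+1). *)
Fixpoint hsym (r n l : nat) : R :=
  if r is r'.+1 then \sum_(j < n) hsym r' j.+1 l / (l - j)%:R else 1.

Lemma hsym0 n l : hsym 0 n l = 1. Proof. by []. Qed.

Lemma hsymS r n l :
  hsym r.+1 n l = \sum_(j < n) hsym r j.+1 l / (l - j)%:R.
Proof. by []. Qed.

Lemma hsymS0 r l : hsym r.+1 0 l = 0. Proof. by rewrite /= big_ord0. Qed.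

Lemma hsymSS r n l :
  hsym r.+1 n.+1 l = hsym r.+1 n l + hsym r n.+1 l / (l - n)%:R.
Proof. by rewrite /= big_ord_recr. Qed.

Lemma hsym_ge0 r n l : 0 <= hsym r n l.
Proof.
elim: r n => [|r IH] n //=.
by apply: sumr_ge0 => j _; rewrite divr_ge0.
Qed.

(** Counterpart of [hsymSS] at the other end: it splits off the first variable 1/(l+1), where
    [hsymSS] splits off the last. Double induction on the degree and the number of variables. *)
Lemma hsym_recl r n l :
  hsym r.+1 n.+1 l.+1 = hsym r.+1 n l + hsym r n.+1 l.+1 / l.+1%:R.
Proof.
elim: r n => [|r IHr] n; elim: n => [|n IHn].
- by rewrite hsymSS !hsymS0 subn0 !add0r.
- by rewrite hsymSS IHn hsymSS !hsym0 subSS addrAC.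
- by rewrite hsymSS !hsymS0 subn0 !add0r.
rewrite hsymSS IHn (hsymSS r.+1 n l) [X in _ + X / (l.+1 - _)%:R]IHr subSS.
rewrite (hsymSS r n.+1 l.+1) subSS !mulrDl; ring.
Qed.

(** Splitting h_{r+1}(1/(l+1), ..., 1/(l-k)) at its first and at its last variable gives two
    expressions for it; equating them yields the difference on the right, because 1/(l-k) - 1/(l+1)
    = (k+1) / ((l-k)(l+1)). *)
Lemma hsym_telescope r k l : (k < l)%N ->
  hsym r k.+2 l.+1 / (l - k)%:R / l.+1%:R
  = (hsym r.+1 k.+1 l - hsym r.+1 k.+1 l.+1) / k.+1%:R.
Proof.
move=> kl.
have := hsym_recl r k.+1 l; rewrite hsymSS subSS => /eqP.
rewrite -subr_eq -addrA => /eqP e.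
have -> : hsym r.+1 k.+1 l - hsym r.+1 k.+1 l.+1 =
    hsym r k.+2 l.+1 / (l - k)%:R - hsym r k.+2 l.+1 / l.+1%:R.
  by rewrite -e addrAC subrr add0r.
have ne1 : (l - k)%:R != 0 :> R by rewrite pnatr_eq0 subn_eq0 -ltnNge.
have e2 : l.+1%:R = (l - k)%:R + k.+1%:R :> R by rewrite -natrD addnS subnK // ltnW.
have ne3 : (l - k)%:R + k.+1%:R != 0 :> R by rewrite -e2 pnatr_eq0.
have ne4 : k.+1%:R != 0 :> R by rewrite pnatr_eq0.
by rewrite e2; field; rewrite nat1r ne1 ne3 ne4.
Qed.

Lemma sum_hsym_telescope r k L : (k < L)%N ->
  \sum_(k.+1 <= l < L) hsym r k.+2 l.+1 / (l - k)%:R / l.+1%:R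
  = (hsym r.+1 k.+1 k.+1 - hsym r.+1 k.+1 L) / k.+1%:R.
Proof.
elim: L => [//|L IH]; rewrite ltnS leq_eqVlt => /predU1P[->|kL].
  by rewrite big_geq // subrr mul0r.
by rewrite big_nat_recr //= IH // hsym_telescope // -mulrDl addrA subrK.
Qed.

(** Makes the boundary term at [L] in [sum_hsym_telescope] disappear in the limit. *)
Lemma hsym_cvg0 r n : hsym r.+1 n L @[L --> \oo] --> 0.
Proof.
have xcvg j : ((L - j)%:R : R)^-1 @[L --> \oo] --> 0.
  rewrite -(cvg_shiftn j.+1) /=.
  under eq_fun do rewrite addnS -addSn addnK.
  exact: cvg_harmonic.
elim: r n => [|r IH] n /=.
  rewrite [X in _ --> X](_ : 0 = \sum_(j < n) (1 * 0 : R)); last first.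
    by rewrite big1 // => *; rewrite mulr0.
  apply: cvg_big => [|k _]; first exact: add_continuous.
  by apply: cvgM => //; exact: cvg_cst.
rewrite [X in _ --> X](_ : 0 = \sum_(j < n) (0 * 0 : R)); last first.
  by rewrite big1 // => *; rewrite mulr0.
apply: cvg_big => [|k _]; first exact: add_continuous.
by apply: cvgM => //; exact: IH.
Qed.

(** In the defining sum of h_{r+1} over [j], the subtracted terms are exactly those with [j = k.+1],
    that is, with [j > m]. *)
Lemma hsym_gap r m l : (m <= l)%N ->
  hsym r.+1 l.+1 l.+1 - \sum_(m <= k < l) hsym r k.+2 l.+1 / (l - k)%:R
  = hsym r.+1 m.+1 l.+1.
Proof.
move=> ml; apply/eqP; rewrite subr_eq; apply/eqP; rewrite !hsymS.
rewrite -!(big_mkord xpredT (fun j => hsym r j.+1 l.+1 / (l.+1 - j)%:R)).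
rewrite (big_cat_nat _ (n := m.+1)) //=; congr (_ + _).
by rewrite big_add1 /=; apply: eq_bigr => k _; rewrite subSS.
Qed.

Lemma hsym_one r l : hsym r 1 l.+1 = l.+1%:R ^- r.
Proof.
elim: r => [|r IH]; first by rewrite expr0 invr1.
by rewrite hsymSS hsymS0 add0r IH subn0 exprS invfM mulrC.
Qed.

(* A weight of order sqrt n, chosen because the recurrence of
   h_r(1, 1/2, ..., 1/n) and the tails of sum w(k)/k^2 telescope exactly. *)
Definition sqrtw (n : nat) : R := \prod_(j < n) ((j.*2.+2)%:R / (j.*2.+1)%:R).

Lemma sqrtwS n : sqrtw n.+1 = sqrtw n * ((n.*2.+2)%:R / (n.*2.+1)%:R).
Proof. by rewrite /sqrtw big_ord_recr. Qed.

Lemma sqrtw_gt0 n : 0 < sqrtw n.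
Proof. by apply: prodr_gt0 => j _; rewrite divr_gt0. Qed.

Lemma sqrtw_ge1 n : 1 <= sqrtw n.
Proof.
elim: n => [|n IH]; first by rewrite /sqrtw big_ord0.
rewrite sqrtwS mulr_ege1 //.
by rewrite ler_pdivlMr ?ltr0n // mul1r ler_nat.
Qed.

(** Splitting off 1/(n+1) gives a recurrence that the bound satisfies with equality, since w(n+1) -
    w(n) = w(n+1) / (2(n+1)) for w = [sqrtw]; each degree therefore costs a factor 2. *)
Lemma hsym_le_sqrtw r n : hsym r n n <= 2 ^+ r * sqrtw n.
Proof.
elim: r n => [|r IHr] n; first by rewrite mul1r sqrtw_ge1.
elim: n => [|n IHn]; first by rewrite hsymS0 mulr_ge0 ?exprn_ge0 // ltW // sqrtw_gt0.
rewrite hsym_recl.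
have := IHr n.+1; rewrite -(ler_pM2r (x := n.+1%:R^-1)) ?invr_gt0 ?ltr0n // => h.
apply: le_trans (lerD IHn h) _.
rewrite le_eqVlt sqrtwS; apply/orP; left; apply/eqP.
rewrite exprS -!mul2n -!natr1 !natrM; field.
by rewrite -natrM !natr1 !pnatr_eq0.
Qed.

(** With w = [sqrtw], the term w(k+1)/(k+1)^2 is at most 2 w(k)/k - 2 w(k+1)/(k+1), the slack being
    2 w(k) / (k (k+1) (2k+1)). The induction keeps the boundary term at [K] so that these
    differences telescope. *)
Lemma sum_sqrtw_tail m K :
  \sum_(m.+1 <= k < K) sqrtw k.+1 / k.+1%:R ^+ 2 <= 2 * (sqrtw m.+1 / m.+1%:R).
Proof.
have [mK|Km] := ltnP m K; last first.
  rewrite big_geq; last exact: leq_trans Km _.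
  by rewrite mulr_ge0 // divr_ge0 // ltW // sqrtw_gt0.
suff : \sum_(m.+1 <= k < K) sqrtw k.+1 / k.+1%:R ^+ 2 <=
       2 * (sqrtw m.+1 / m.+1%:R) - 2 * (sqrtw K / K%:R).
  move=> /le_trans; apply; rewrite gerBl mulr_ge0 // divr_ge0 // ltW //.
  exact: sqrtw_gt0.
elim: K mK => [//|K IH]; rewrite ltnS leq_eqVlt => /predU1P[->|mK].
  by rewrite big_geq // subrr.
rewrite big_nat_recr //=; apply: le_trans (lerD (IH mK) (lexx _)) _.
(* As [K] is positive, shifting it by one makes every denominator a positive linear form in
   [x >= 0]. *)
case: K mK {IH} => // K _.
rewrite -addrA lerD2l -subr_ge0 (sqrtwS K.+1).
set w := sqrtw K.+1.
have w0 : 0 < w by exact: sqrtw_gt0.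
pose x : R := K%:R.
have x0 : 0 <= x by exact: ler0n.
have e1 : K.+1%:R = x + 1 :> R by rewrite -natr1.
have e2 : K.+2%:R = x + 2 :> R by rewrite -!natr1 -/x; ring.
have e3 : K.+1.*2.+2%:R = 2 * x + 4 :> R.
  have -> : (K.+1.*2.+2 = 2 * K + 4)%N by lia.
  by rewrite natrD natrM.
have e4 : K.+1.*2.+1%:R = 2 * x + 3 :> R.
  have -> : (K.+1.*2.+1 = 2 * K + 3)%N by lia.
  by rewrite natrD natrM.
rewrite e1 e2 e3 e4.
have -> : - (2 * (w * ((2 * x + 4) / (2 * x + 3)) / (x + 2))) -
   (- (2 * (w / (x + 1))) + w * ((2 * x + 4) / (2 * x + 3)) / (x + 2) ^+ 2) =
   w * (2 * ((x + 1) * (x + 2) * (2 * x + 3))^-1).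
  by field; do ?[apply/andP; split]; apply/eqP; lra.
by rewrite mulr_ge0 ?(ltW w0) // mulr_ge0 // invr_ge0 !mulr_ge0 //; lra.
Qed.

End CompleteHomogeneous.

Arguments hsym : simpl never.

(** * Powers of integers, truncated multiple zeta sums and their absolute summability *)

Section NatPow.
Variable R : realType.

Definition rpowN (n : nat) (x : R) : R := expR (- x * ln (n%:R : R)).

Lemma rpowN_gt0 n x : 0 < rpowN n x. Proof. exact: expR_gt0. Qed.

Lemma rpowND n x y : rpowN n (x + y) = rpowN n x * rpowN n y.
Proof. by rewrite /rpowN -expRD -mulrDl opprD. Qed.

Lemma rpowN_nat n m : rpowN n.+1 m%:R = n.+1%:R ^- m.
Proof.
rewrite /rpowN mulNr expRN expRM_natl lnK //.
by rewrite posrE ltr0n.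
Qed.

Lemma rpowN_natN n m : rpowN n.+1 (- m%:R) = n.+1%:R ^+ m.
Proof. by rewrite /rpowN opprK expRM_natl lnK // posrE ltr0n. Qed.

Lemma le_rpowN n m x : 0 <= x -> (n <= m)%N -> rpowN m.+1 x <= rpowN n.+1 x.
Proof.
move=> x0 nm; rewrite /rpowN ler_expR !mulNr lerN2 ler_wpM2l // ler_ln ?posrE ?ltr0n //.
by rewrite ler_nat.
Qed.

Lemma natpowND n (s s' : R[i]) : natpowN n (s + s') = natpowN n s * natpowN n s'.
Proof.
rewrite /natpowN opprD mulrDl.
move: (- s * _) (- s' * _) => [a b] [a' b']; rewrite /cexp /= expRD sinD cosD.
by apply/eqP; rewrite eq_complex /=; apply/andP; split; apply/eqP; ring.
Qed.

Lemma natpowN_real n (x : R) : natpowN n x%:C%C = (rpowN n x)%:C%C.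
Proof.
rewrite /natpowN -rmorphN -rmorphM /cexp /= sin0 cos0; exact: mulr1.
Qed.

Lemma natpowN_nat n m : natpowN n.+1 (m%:R : R[i]) = (n.+1%:R ^- m : R)%:C%C.
Proof. by rewrite -rpowN_nat -natpowN_real rmorph_nat. Qed.

Lemma natpowN_natN n m : natpowN n.+1 (- m%:R : R[i]) = (n.+1%:R ^+ m : R)%:C%C.
Proof. by rewrite -rpowN_natN -natpowN_real rmorphN rmorph_nat. Qed.

Lemma natpowN_subS k (s : R[i]) m : natpowN k.+1 (s - m%:R) =
  natpowN k.+1 (s - m.+1%:R) * (k.+1%:R^-1 : R)%:C%C.
Proof.
have -> : s - m%:R = (s - m.+1%:R) + 1%:R by rewrite -natr1; ring.
by rewrite natpowND natpowN_nat expr1.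
Qed.

Lemma rpowN_subS k (x : R) m : rpowN k.+1 (x - m%:R) =
  rpowN k.+1 (x - m.+1%:R) / k.+1%:R.
Proof.
have -> : x - m%:R = (x - m.+1%:R) + 1%:R by rewrite -natr1; ring.
by rewrite rpowND rpowN_nat expr1.
Qed.

Lemma normc_natpowN n (s : R[i]) : Normc.normc (natpowN n s) = rpowN n (complex.Re s).
Proof.
have -> : rpowN n (complex.Re s) = expR (complex.Re (- s * (ln (n%:R : R))%:C%C)).
  by rewrite Re_scale raddfN.
rewrite /natpowN; move: (- s * _) => [a b]; rewrite /cexp Normc.normcM /=.
by rewrite expr0n addr0 sqrtr_sqr cos2Dsin2 sqrtr1 mulr1 ger0_norm // expR_ge0.
Qed.

(* The multiple sum over 1 <= n_1 < ... < n_a <= k, where [u] lists the exponents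
   from the outermost one, that of n_a, to that of n_1. *)
Fixpoint mzeta_trunc (u : seq R[i]) (k : nat) : R[i] :=
  if u is x :: u' then \sum_(j < k) mzeta_trunc u' j * natpowN j.+1 x else 1.

(** The separate bound [K] carries the induction: the last entry [k] of an increasing tuple is its
    largest, and once it is removed the other entries range over the increasing tuples bounded by
    [k]. *)
Lemma mzeta_sum_bounded (t : seq R[i]) (r N K : nat) : size t = r -> (K <= N)%N ->
  \sum_(n : r.-tuple 'I_N | sorted ltn [seq val k | k <- n] &&
                            all (fun k : 'I_N => k < K)%N n)
    \prod_(i < r) natpowN (tnth n i).+1 t`_i = mzeta_trunc (rev t) K.
Proof.
elim/last_ind: t r K => [|t x IH] r K.
  move=> /= <- _; rewrite (big_pred1 [tuple]) => [|n]; first by rewrite big_ord0.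
  by rewrite tuple0 /= !eqxx.
rewrite size_rcons => <- KN; rewrite rev_rcons /=.
have hbij : bijective (fun p : 'I_N * (size t).-tuple 'I_N => [tuple of rcons p.2 p.1]).
  apply: inj_card_bij; last by rewrite card_prod !card_tuple expnS.
  by move=> [k n] [k' n'] /(congr1 val) /= /rcons_inj [/val_inj -> ->].
rewrite (reindex _ (onW_bij _ hbij)) /=.
rewrite (eq_bigl (fun p : 'I_N * (size t).-tuple 'I_N => (p.1 < K)%N &&
   (sorted ltn [seq val k | k <- p.2] &&
    all (fun k : 'I_N => k < p.1)%N p.2))); last first.
  move=> [k n] /=; rewrite !sorted_pairwise; [|exact: ltn_trans..].
  rewrite map_rcons pairwise_rcons all_rcons all_map /=.
  have [kK|] := boolP (k < K)%N; last by rewrite andbF.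
  rewrite /= [X in X && _]andbC -andbA; congr (_ && _).
  apply/andP/idP => [[] //|nk]; split=> //.
  by apply: sub_all nk => j jk; exact: ltn_trans jk kK.
rewrite -(pair_big_dep (fun k : 'I_N => (k < K)%N)
  (fun k (n : (size t).-tuple _) =>
     sorted ltn [seq val i | i <- n] && all (fun i : 'I_N => i < k)%N n)
  (fun k (n : (size t).-tuple 'I_N) =>
     \prod_(i < (size t).+1)
       natpowN (tnth [tuple of rcons n k] i).+1 (rcons t x)`_i)) /=.
rewrite (big_ord_widen_cond N xpredT
  (fun k => mzeta_trunc (rev t) k * natpowN k.+1 x)) //=.
apply: eq_bigr => k kK.
rewrite -(IH _ k erefl (ltnW (ltn_ord k))) mulr_suml.
apply: eq_bigr => n _; rewrite big_ord_recr /=; congr (_ * _).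
  apply: eq_bigr => i _.
  by rewrite !(tnth_nth k) /= !nth_rcons size_tuple ltn_ord.
by rewrite (tnth_nth k) /= !nth_rcons size_tuple ltnn eqxx.
Qed.

Lemma mzeta_partialE (t : seq R[i]) N :
  mzeta_partial (row_of_seq t) N = mzeta_trunc (rev t) N.
Proof.
rewrite -(@mzeta_sum_bounded t _ N N erefl (leqnn N)) /mzeta_partial.
apply: eq_big => [n|n _].
  by rewrite [X in _ && X](_ : _ = true) ?andbT //; apply/allP => i _; exact: ltn_ord.
by apply: eq_bigr => i _; rewrite mxE.
Qed.

Fixpoint rmzeta_trunc (v : seq R) (k : nat) : R :=
  if v is x :: v' then \sum_(j < k) rmzeta_trunc v' j * rpowN j.+1 x else 1.

Lemma rmzeta_trunc_ge0 v k : 0 <= rmzeta_trunc v k.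
Proof.
elim: v k => [|x v IH] k //=.
by apply: sumr_ge0 => j _; rewrite mulr_ge0 // ltW // rpowN_gt0.
Qed.

Lemma le_rmzeta_trunc v k l : (k <= l)%N -> rmzeta_trunc v k <= rmzeta_trunc v l.
Proof.
case: v => [//|x v] kl /=.
rewrite -!(big_mkord xpredT (fun j => rmzeta_trunc v j * rpowN j.+1 x)).
rewrite [X in _ <= X](big_cat_nat _ kl) //= lerDl sumr_ge0 // => j _.
by rewrite mulr_ge0 ?rmzeta_trunc_ge0 // ltW // rpowN_gt0.
Qed.

Lemma normc_mzeta_trunc u k :
  Normc.normc (mzeta_trunc u k) <= rmzeta_trunc [seq complex.Re x | x <- u] k.
Proof.
elim: u k => [|x u IH] k; first by rewrite [mzeta_trunc _ _]/(1 : R[i]) Normc.normc1.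
apply: le_trans (normc_sum _ _ _) _; apply: ler_sum => j _.
by rewrite Normc.normcM normc_natpowN ler_wpM2r // ltW // rpowN_gt0.
Qed.

(* With the exponent [x] of the outermost variable put in front of [v], every
   tail sum of the exponents is at least its number of terms plus 1. *)
Fixpoint tails_ge (v : seq R) (x : R) : Prop :=
  2 <= x /\ (if v is y :: v' then tails_ge v' (y + x - 1) else True).

Lemma tails_ge2 v x : tails_ge v x -> 2 <= x.
Proof. by case: v => [|y v] []. Qed.

(** Sum over the outermost variable l > m first: since x >= 2, l^{-x} <= m^{2-x} l^{-2}, and
    [sum_sqrtw_tail] returns the same weight at m with an extra factor 2/m. The next variable thus
    gets the exponent y + x - 1, as in the recursion of [tails_ge]. *)
Lemma rmzeta_trunc_summable v x : tails_ge v x ->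
  exists A : R, forall K,
    \sum_(k < K) rpowN k.+1 x * rmzeta_trunc v k * sqrtw R k.+1 <= A.
Proof.
have pw m k (y : R) : 2 <= y -> (m <= k)%N ->
    rpowN k.+1 y <= rpowN m.+1 (y - 2) / k.+1%:R ^+ 2.
  move=> y2 mk; have {1}-> : y = (y - 2) + 2%:R by rewrite subrK.
  rewrite rpowND rpowN_nat.
  by rewrite ler_wpM2r ?invr_ge0 ?exprn_ge0 // le_rpowN // subr_ge0.
elim: v x => [|y v IH] x; last first.
  move=> /= [x2 /IH [A HA]]; exists (2 * A) => K.
  apply: le_trans (_ : 2 * \sum_(m < K)
    rpowN m.+1 (y + x - 1) * rmzeta_trunc v m * sqrtw R m.+1 <= _); last first.
    by rewrite ler_pM2l.
  under eq_bigr => k _ do rewrite mulr_sumr mulr_suml.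
  rewrite (triangle_swap (fun l m =>
    rpowN l.+1 x * (rmzeta_trunc v m * rpowN m.+1 y) * sqrtw R l.+1)).
  rewrite mulr_sumr; apply: ler_sum => m _.
  have -> : 2 * (rpowN m.+1 (y + x - 1) * rmzeta_trunc v m * sqrtw R m.+1) =
     rmzeta_trunc v m * rpowN m.+1 y * rpowN m.+1 (x - 2) *
     (2 * (sqrtw R m.+1 / m.+1%:R)).
    have -> : y + x - 1 = y + (x - 2) + 1 by ring.
    by rewrite !rpowND (rpowN_nat m 1) expr1; ring.
  have c0 : 0 <= rmzeta_trunc v m * rpowN m.+1 y * rpowN m.+1 (x - 2).
    by rewrite !mulr_ge0 ?rmzeta_trunc_ge0 ?ltW ?rpowN_gt0.
  apply: le_trans (ler_wpM2l c0 (sum_sqrtw_tail R m K)).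
  rewrite mulr_sumr; apply: ler_sum_nat => k /andP[mk _].
  rewrite [X in X <= _](_ : _ = rmzeta_trunc v m * rpowN m.+1 y *
    (rpowN k.+1 x * sqrtw R k.+1)); last by ring.
  rewrite [X in _ <= X](_ : _ = rmzeta_trunc v m * rpowN m.+1 y *
    (rpowN m.+1 (x - 2) / k.+1%:R ^+ 2 * sqrtw R k.+1)); last by ring.
  rewrite ler_wpM2l ?mulr_ge0 ?rmzeta_trunc_ge0 ?(ltW (rpowN_gt0 _ _)) //.
  by rewrite ler_wpM2r ?(ltW (sqrtw_gt0 _ _)) // pw // ltnW.
(* In the constant 3, the first term accounts for 1 and the tail bound at [m = 0] for 2. *)
move=> [x2 _]; exists (3 * sqrtw R 1) => K.
case: K => [|K]; first by rewrite big_ord0 mulr_ge0 // ltW // sqrtw_gt0.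
rewrite -(big_mkord xpredT
  (fun k => rpowN k.+1 x * rmzeta_trunc [::] k * sqrtw R k.+1)).
rewrite big_ltn //= !mulr1 [3](_ : _ = 1 + 2) // mulrDl.
have r1 z : rpowN 1 z = 1 by rewrite /rpowN ln1 mulr0 expR0.
rewrite r1 lerD2l.
apply: le_trans (_ : 2 * (sqrtw R 1 / 1%:R) <= _); last by rewrite divr1.
apply: le_trans (sum_sqrtw_tail R 0 K.+1); apply: ler_sum_nat => k _.
rewrite mulr1 [X in _ <= X]mulrC ler_wpM2r ?(ltW (sqrtw_gt0 _ _)) //.
by have := pw 0 k x x2 (leq0n k); rewrite r1 mul1r.
Qed.

End NatPow.

(** * Domain of convergence, coefficients of the closed form, and the summation kernel *)

Section ClosedForm.
Variable R : realType.
Implicit Types (u : seq R[i]) (s : R[i]) (v : seq R).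

Lemma tails_ge_sum v x l : tails_ge v x -> (l <= size v)%N ->
  (size v - l)%:R + 2 <= x + \sum_(l <= i < size v) (rev v)`_i.
Proof.
elim: v x l => [|y v IH] x l /= [x2 h] lv.
  by rewrite sub0n big_geq // addr0 add0r.
move: lv; rewrite leq_eqVlt => /predU1P[->|].
  by rewrite subnn big_geq // addr0 add0r.
rewrite ltnS => lv; rewrite big_nat_recr //= rev_cons nth_rcons size_rev ltnn eqxx.
rewrite (eq_big_nat _ _ (F2 := fun i => (rev v)`_i)) => [|i /andP[_ iv]].
  by have := IH _ _ h lv; rewrite subSn // -natr1; lra.
by rewrite nth_rcons size_rev iv.
Qed.

Lemma tails_ge_domain u s : tails_ge [seq complex.Re x | x <- u] (complex.Re s) ->
  mzeta_domain (row_of_seq (rcons (rev u) s)).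
Proof.
move=> h l.
have sz : size (rcons (rev u) s) = (size u).+1 by rewrite size_rcons size_rev.
have lu : (l <= size u)%N by rewrite -ltnS -sz.
have := tails_ge_sum h (l := l); rewrite size_map => /(_ lu) H.
rewrite raddf_sum /=; under eq_bigr do rewrite mxE.
rewrite -(big_mkord (fun i => (l <= i)%N) (fun i => complex.Re (rcons (rev u) s)`_i)).
move: (nat_of_ord l) lu H => {}l lu H; rewrite sz.
rewrite -(big_nat_widenl l 0 (size u).+1 xpredT) //= big_nat_recr //=.
rewrite nth_rcons size_rev ltnn eqxx.
rewrite (eq_big_nat _ _ (F2 := fun i => (rev [seq complex.Re x | x <- u])`_i)).
  by rewrite subSn // -natr1; lra.
move=> i /andP[_ iu]; rewrite nth_rcons size_rev iu -map_rev.
by rewrite (nth_map 0) // size_rev.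
Qed.

(* The coefficient of (l+1)^{r-s} in the multiple series for G_{a,r+1}(rev u; s). *)
Definition G_coef (r : nat) u (l : nat) : R[i] :=
  if u is x :: u' then
    \sum_(k < l) mzeta_trunc u' k * natpowN k.+1 x * (hsym R r k.+2 l.+1)%:C%C
  else (l.+1%:R ^- r)%:C%C.

Lemma G_coef0 u l : G_coef 0 u l = mzeta_trunc u l.
Proof.
case: u => [|x u] /=; first by rewrite expr0 invr1.
by apply: eq_bigr => k _; rewrite mulr1.
Qed.

(** Apply [hsym_gap] to each h_{r+1} in the coefficient, with [m = k.+1], or [m = 0] if [u] is
    empty, and exchange the two triangular sums. The first term feeds the telescoping series, the
    second matches a part of the kernel. *)
Lemma G_coefS r u l : G_coef r.+1 u l =
  mzeta_trunc u l * (hsym R r.+1 l.+1 l.+1)%:C%C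
  - \sum_(k < l) mzeta_trunc u k * (hsym R r k.+2 l.+1 / (l - k)%:R)%:C%C.
Proof.
case: u => [|x u].
  rewrite /G_coef -hsym_one -(hsym_gap R r (leq0n l)).
  rewrite rmorphB [X in _ - X]rmorph_sum /= mul1r.
  by under [in RHS]eq_bigr do rewrite mul1r; rewrite big_mkord.
rewrite [mzeta_trunc _ l]/= mulr_suml.
under [X in _ - X]eq_bigr do rewrite [mzeta_trunc _ _]/= mulr_suml.
rewrite (triangle_swap (fun l' k => mzeta_trunc u k * natpowN k.+1 x *
  (hsym R r l'.+2 l.+1 / (l - l')%:R)%:C%C)) -sumrB.
apply: eq_bigr => k _.
rewrite -(hsym_gap R r (ltn_ord k)) rmorphB [X in _ * (_ - X)]rmorph_sum /=.
by rewrite mulrBr mulr_sumr.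
Qed.

(* G_kernel r u s l k * ((k+1)/(l+1))^n is the contribution of the two outermost
   summation variables k+1 < l+1 to the n-th term of the series for G_{a,r+2}. *)
Definition G_kernel (r : nat) u s (l k : nat) : R[i] :=
  mzeta_trunc u k *
  (natpowN k.+1 (s - r.+2%:R) * (l.+1%:R ^- 2)%:C%C - natpowN l.+1 (s - r%:R))
  * (hsym R r k.+2 l.+1)%:C%C.

(** With k and l the integers [k.+1] and [l.+1], both products depend on n only through (k/l)^n, so
    the series over n is geometric. *)
Lemma G_kernelE r u s n l :
  natpowN l.+1 (n%:R + r.+2%:R - r%:R) * G_coef r ((s - n%:R - r.+2%:R) :: u) l
  - natpowN l.+1 (s + n%:R - r%:R) * G_coef r (- n%:R :: u) l
  = \sum_(k < l) G_kernel r u s l k * ((k.+1%:R / l.+1%:R) ^+ n)%:C%C.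
Proof.
have -> : n%:R + r.+2%:R - r%:R = n.+2%:R :> R[i] by rewrite -!natr1; ring.
have -> : s + n%:R - r%:R = (s - r%:R) + n%:R by ring.
rewrite natpowN_nat natpowND natpowN_nat /= !mulr_sumr -sumrB.
apply: eq_bigr => k _.
have -> : s - n%:R - r.+2%:R = (s - r.+2%:R) + (- n%:R) by ring.
rewrite natpowND natpowN_natN /G_kernel expr_div_n -addn2 exprD invfM !rmorphM /=.
ring.
Qed.

(** The factor (l+1)/(l-k) is the sum of the geometric series in [n]. The two halves of the kernel
    are dominated by [X] and [Y]: summing [X] over [l] telescopes, summing [Y] over [k] is
    controlled by [hsym_gap] at [m = 0], and both results are at most [a], which [hsym_le_sqrtw]
    makes summable. *)
Lemma G_kernel_summable r u s :
  tails_ge [seq complex.Re x | x <- u] (complex.Re s - r.+1%:R) ->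
  exists A : R, forall L,
    \sum_(l < L) \sum_(k < l)
      Normc.normc (G_kernel r u s l k) * (l.+1%:R / (l - k)%:R) <= A.
Proof.
set v := map _ _; set x := complex.Re s => h.
have [A0 HA0] := rmzeta_trunc_summable h.
pose a k := rpowN k.+1 (x - r.+1%:R) * rmzeta_trunc v k * hsym R r.+1 k.+1 k.+1.
have Ha L : \sum_(k < L) a k <= 2 ^+ r.+1 * A0.
  apply: le_trans (ler_wpM2l _ (HA0 L)); last by rewrite exprn_ge0.
  rewrite mulr_sumr; apply: ler_sum => k _.
  rewrite mulrCA ler_wpM2l ?hsym_le_sqrtw //.
  by rewrite mulr_ge0 ?rmzeta_trunc_ge0 // ltW // rpowN_gt0.
pose X l k := rmzeta_trunc v k * rpowN k.+1 (x - r.+2%:R) *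
  (hsym R r k.+2 l.+1 / (l - k)%:R / l.+1%:R).
pose Y l k := rpowN l.+1 (x - r.+1%:R) *
  (rmzeta_trunc v k * (hsym R r k.+2 l.+1 / (l - k)%:R)).
exists (2 ^+ r.+1 * A0 + 2 ^+ r.+1 * A0) => L.
apply: (@le_trans _ _ (\sum_(l < L) \sum_(k < l) X l k +
  \sum_(l < L) \sum_(k < l) Y l k)).
  rewrite -big_split /=; apply: ler_sum => l _.
  rewrite -big_split /=; apply: ler_sum => k _.
  rewrite /G_kernel !Normc.normcM.
  set n1 := Normc.normc (mzeta_trunc _ _); set n2 := Normc.normc (_ - _).
  rewrite (normc_real (hsym_ge0 _ _ _ _)).
  have hn1 : n1 <= rmzeta_trunc v k by exact: normc_mzeta_trunc.
  have hn2 : n2 <= rpowN k.+1 (x - r.+2%:R) * l.+1%:R ^- 2 + rpowN l.+1 (x - r%:R).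
    apply: le_trans (le_normcD _ _) _; rewrite normcN Normc.normcM !normc_natpowN.
    rewrite !raddfB /= !Re_natr expr0n addr0 sqrtr_sqr ger0_norm //.
  have c0 : 0 <= hsym R r k.+2 l.+1 * (l.+1%:R / (l - k)%:R).
    by rewrite mulr_ge0 ?hsym_ge0 // divr_ge0.
  rewrite -mulrA; apply: le_trans (ler_wpM2r c0 (ler_pM _ _ hn1 hn2)) _.
  - exact: normc_nneg.
  - exact: normc_nneg.
  rewrite le_eqVlt /X /Y (rpowN_subS _ _ r) (rpowN_subS _ _ r.+1).
  apply/orP; left; apply/eqP.
  have lk : (l - k)%:R != 0 :> R by rewrite pnatr_eq0 subn_eq0 -ltnNge.
  by field; rewrite lk nat1r pnatr_eq0.
apply: lerD; last first.
  apply: le_trans (Ha L); apply: ler_sum => l _.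
  rewrite -mulr_sumr /a -mulrA ler_wpM2l ?(ltW (rpowN_gt0 _ _)) //.
  apply: (@le_trans _ _ (rmzeta_trunc v l *
    \sum_(k < l) (hsym R r k.+2 l.+1 / (l - k)%:R))).
    rewrite mulr_sumr; apply: ler_sum => k _.
    by rewrite ler_wpM2r ?divr_ge0 ?hsym_ge0 // le_rmzeta_trunc // ltnW.
  rewrite ler_wpM2l ?rmzeta_trunc_ge0 // -subr_ge0.
  rewrite -(big_mkord xpredT (fun k => hsym R r k.+2 l.+1 / (l - k)%:R)).
  by rewrite hsym_gap // hsym_ge0.
rewrite (triangle_swap X).
apply: le_trans (Ha L); apply: ler_sum => k _.
rewrite /X -mulr_sumr sum_hsym_telescope // /a (rpowN_subS _ _ r.+1).
rewrite [X in _ <= X](_ : _ = rmzeta_trunc v k * rpowN k.+1 (x - r.+2%:R) *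
  (hsym R r.+1 k.+1 k.+1 / k.+1%:R)); last by ring.
rewrite ler_wpM2l ?mulr_ge0 ?rmzeta_trunc_ge0 ?(ltW (rpowN_gt0 _ _)) //.
by rewrite ler_wpM2r ?invr_ge0 // gerBl hsym_ge0.
Qed.

End ClosedForm.

(** * Exchange of the infinite sums and induction on the number of recursion levels *)

Section MainStep.
Variable R : realType.
Implicit Types (u : seq R[i]) (s : R[i]).

(** Exchanging the sums over a finite triangle and telescoping over [l] turns the second partial sum
    into the first one, up to a correction h_{r+1}(1/L, ..., 1/(L-k)) in each term. It tends to 0
    for fixed [k], and dominated convergence applies. *)
Lemma triangle_series_swap r u s :
  tails_ge [seq complex.Re x | x <- u] (complex.Re s - r.+1%:R) ->
  exists d,
    ccvg (fun L => \sum_(l < L) natpowN l.+1 (s - r.+1%:R) *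
            (mzeta_trunc u l * (hsym R r.+1 l.+1 l.+1)%:C%C)) d /\
    ccvg (fun L => \sum_(l < L) \sum_(k < l)
            mzeta_trunc u k * natpowN k.+1 (s - r.+2%:R) *
            (hsym R r k.+2 l.+1 / (l - k)%:R / l.+1%:R)%:C%C) d.
Proof.
move=> h; have [A0 HA0] := rmzeta_trunc_summable h.
set c := fun k => natpowN k.+1 (s - r.+1%:R) * mzeta_trunc u k.
pose D k := c k * (hsym R r.+1 k.+1 k.+1)%:C%C.
have HD L : \sum_(k < L) Normc.normc (D k) <= 2 ^+ r.+1 * A0.
  apply: le_trans (ler_wpM2l _ (HA0 L)); last by rewrite exprn_ge0.
  rewrite mulr_sumr; apply: ler_sum => k _.
  rewrite /D /c 2!Normc.normcM normc_natpowN normc_real ?hsym_ge0 //.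
  rewrite raddfB /= Re_natr mulrCA.
  rewrite ler_pM ?mulr_ge0 ?normc_nneg ?hsym_ge0 ?(ltW (rpowN_gt0 _ _)) //.
    by rewrite ler_wpM2l ?normc_mzeta_trunc ?(ltW (rpowN_gt0 _ _)).
  exact: hsym_le_sqrtw.
have [d Dd] := abs_cseries_cvg HD.
exists d; split.
  by under [X in ccvg X]eq_fun do under eq_bigr do rewrite mulrA.
(* Extension by 0 beyond [L] turns the finite triangular sum into a series in [k]. *)
pose f L k := if (k < L)%N then
   c k * (hsym R r.+1 k.+1 k.+1 - hsym R r.+1 k.+1 L)%:C%C else 0.
apply: (@ctannery R f D (fun k => Normc.normc (D k)) _ d _ HD) => //.
- move=> L k; rewrite /f /D; case: ifP => kL; last by rewrite Normc.normc0 normc_nneg.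
  have h0 : 0 <= hsym R r.+1 k.+1 k.+1 - hsym R r.+1 k.+1 L.
    have := sum_hsym_telescope R r kL => /(congr1 (fun x => x * k.+1%:R)).
    rewrite divfK ?pnatr_eq0 // => <-; rewrite mulr_ge0 // sumr_ge0 // => l _.
    by rewrite !divr_ge0 // hsym_ge0.
  rewrite (Normc.normcM (c k) (hsym _ _ _ _)%:C%C) Normc.normcM.
  rewrite ler_wpM2l ?normc_nneg //.
  by rewrite (normc_real h0) (normc_real (hsym_ge0 _ _ _ _)) gerBl hsym_ge0.
- move=> k; apply: (@ccvg_eventually R _ (fun L => c k *
    (hsym R r.+1 k.+1 k.+1 - hsym R r.+1 k.+1 L)%:C%C) _ k.+1).
    by move=> L kL; rewrite /f kL.
  apply: ccvgZ; rewrite -[X in _ --> X]subr0.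
  by apply: cvgB; [exact: cvg_cst|exact: hsym_cvg0].
move=> L; apply: (@ccvg_eventually R _ (fun=> \sum_(k < L) f L k) _ L).
  move=> N LN; rewrite -!(big_mkord xpredT (f L)) (big_cat_nat _ LN) //=.
  rewrite [X in _ + X]big1_seq ?addr0 // => k /andP[_]; rewrite mem_index_iota.
  by move=> /andP[Lk _]; rewrite /f ltnNge Lk.
rewrite (triangle_swap (fun l k => mzeta_trunc u k * natpowN k.+1 (s - r.+2%:R) *
            (hsym R r k.+2 l.+1 / (l - k)%:R / l.+1%:R)%:C%C)).
rewrite [X in ccvg _ X](_ : _ = \sum_(k < L) f L k); first exact: ccvg_cst.
apply: eq_bigr => k _; rewrite /f ltn_ord -mulr_sumr -rmorph_sum sum_hsym_telescope //.
by rewrite /c (natpowN_subS k s r.+1) rmorphM /=; ring.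
Qed.

(** Dominated convergence over the partial geometric sums in [n] identifies the sum of [E] with the
    sum of [g], which is then compared with the closed form. *)
Lemma G_kernel_series_cvg r u s (E : nat -> R[i]) :
  tails_ge [seq complex.Re x | x <- u] (complex.Re s - r.+1%:R) ->
  (forall n, ccvg (fun L => \sum_(l < L) \sum_(k < l)
      G_kernel r u s l k * ((k.+1%:R / l.+1%:R) ^+ n)%:C%C) (E n)) ->
  exists z, ccvg (fun N => \sum_(n < N) E n) z /\
    ccvg (fun L => \sum_(l < L) natpowN l.+1 (s - r.+1%:R) * G_coef r.+1 u l) z.
Proof.
move=> h HE; have [A HA] := G_kernel_summable h.
pose q (l k : nat) : R := k.+1%:R / l.+1%:R.
have q01 l k : (k < l)%N -> 0 <= q l k < 1.
  by move=> kl; rewrite divr_ge0 //= ltr_pdivrMr ?ltr0n // mul1r ltr_nat.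
have qV l k : (k < l)%N -> (1 - q l k)^-1 = l.+1%:R / (l - k)%:R.
  move=> kl; rewrite /q; have -> : (l - k)%:R = l.+1%:R - k.+1%:R :> R.
    by rewrite -natrB ?subSS // ltnS ltnW.
  have ne : l.+1%:R - k.+1%:R != 0 :> R by rewrite subr_eq0 eqr_nat; lia.
  rewrite -[X in X - _](@divff _ l.+1%:R) ?pnatr_eq0 // -mulrBl invf_div.
  by [].
pose g l := \sum_(k < l) G_kernel r u s l k * (l.+1%:R / (l - k)%:R)%:C%C.
pose M l := \sum_(k < l) Normc.normc (G_kernel r u s l k) * (l.+1%:R / (l - k)%:R).
pose f N l := \sum_(k < l) G_kernel r u s l k * (\sum_(n < N) q l k ^+ n)%:C%C.
have gM l : Normc.normc (g l) <= M l.
  apply: le_trans (normc_sum _ _ _) _; apply: ler_sum => k _.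
  by rewrite Normc.normcM normc_real // divr_ge0.
have [z gz] : exists z, ccvg (fun L => \sum_(l < L) g l) z.
  by apply: (@abs_cseries_cvg R g A) => L; apply: le_trans (HA L); exact: ler_sum.
exists z; split.
  apply: (@ctannery R f g M _ z A) => //.
  - move=> N l; apply: le_trans (normc_sum _ _ _) _; apply: ler_sum => k _.
    have /andP[q0 _] := q01 _ _ (ltn_ord k).
    rewrite Normc.normcM normc_real ?sumr_ge0 // => [|n _]; last by rewrite exprn_ge0.
    by rewrite ler_wpM2l ?normc_nneg // -qV // sum_geometric_le // q01.
  - move=> l; apply: ccvg_sum => k _; apply: ccvgZ.
    by rewrite -qV //; apply: geometric_cvg; exact: q01.
  - move=> N; have := ccvg_sum (index_enum 'I_N) (P := xpredT) (fun n _ => HE n).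
    congr ccvg; apply: funext => L; rewrite exchange_big /=; apply: eq_bigr => l _.
    rewrite exchange_big /=; apply: eq_bigr => k _.
    by rewrite -mulr_sumr -rmorph_sum.
(* Term by term in [l], the closed form is the first series, minus the second, plus [g]; the first
   two cancel in the limit as both have sum [d]. *)
have [d [Dd Xd]] := triangle_series_swap h.
have := ccvgD (ccvgB Dd Xd) gz; rewrite subrr add0r.
congr ccvg; apply: funext => L; rewrite -sumrB -big_split /=.
apply: eq_bigr => l _; rewrite G_coefS mulrBr -addrA; congr (_ + _).
rewrite mulr_sumr -!sumrN -big_split /=; apply: eq_bigr => k _.
rewrite /G_kernel (natpowN_subS l s r) !rmorphM /=.
have l0 : (l.+1%:R : R)%:C%C != 0 by rewrite fmorph_eq0 pnatr_eq0.
rewrite exprS expr1 invfM !rmorphM !fmorphV /=.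
have lk0 : ((l - k)%:R : R)%:C%C != 0.
  by rewrite fmorph_eq0 pnatr_eq0 subn_eq0 -ltnNge.
move: l0 lk0; move: (l.+1%:R : R)%:C%C ((l - k)%:R : R)%:C%C => x y x0 y0.
by field; rewrite x0 y0.
Qed.

Lemma G_closed_form r u s :
  tails_ge [seq complex.Re x | x <- u] (complex.Re s - r%:R) ->
  G_defined r.+1 (rev u) s /\
  ccvg (fun L => \sum_(l < L) natpowN l.+1 (s - r%:R) * G_coef r u l)
       (G r.+1 (rev u) s).
Proof.
elim: r u s => [|r IH] u s h.
  rewrite subr0 in h.
  have dom := tails_ge_domain h; split; first by left.
  rewrite [G _ _ _]/= /mzeta /mzeta_row asboolT // /mzeta_series.
  have e : mzeta_partial (row_of_seq (rcons (rev u) s)) = mzeta_trunc (s :: u).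
    by apply: funext => N; rewrite mzeta_partialE rev_rcons revK.
  rewrite e.
  have [A HA] := rmzeta_trunc_summable h.
  have [z zP] : exists z,
      ccvg (fun L => \sum_(l < L) mzeta_trunc u l * natpowN l.+1 s) z.
    apply: (@abs_cseries_cvg R (fun l => mzeta_trunc u l * natpowN l.+1 s) A) => L.
    apply: le_trans (HA L); apply: ler_sum => l _.
    rewrite Normc.normcM normc_natpowN mulrC -[leLHS]mulr1.
    rewrite ler_pM ?mulr_ge0 ?normc_nneg ?sqrtw_ge1 ?(ltW (rpowN_gt0 _ _)) //.
    by rewrite ler_wpM2l ?normc_mzeta_trunc ?(ltW (rpowN_gt0 _ _)).
  rewrite (ccvg_lim (zP : ccvg (mzeta_trunc (s :: u)) z)).
  move: zP; congr ccvg; apply: funext => L; apply: eq_bigr => l _.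
  by rewrite G_coef0 subr0 mulrC.
pose E n := G r.+1 (rcons (rev u) (s - n%:R - r.+2%:R)) (n%:R + r.+2%:R)
            - G r.+1 (rcons (rev u) (- n%:R)) (s + n%:R).
have h2 := tails_ge2 h.
(* The outer exponent becomes [n + 2] here and [Re s + n - r] in [H2]. In both cases adding the real
   part of the next exponent and subtracting 1 cancels [n] and leaves [Re s - r.+1], which is
   hypothesis [h]. *)
have H1 n : tails_ge [seq complex.Re x | x <- (s - n%:R - r.+2%:R) :: u]
    (complex.Re (n%:R + r.+2%:R : R[i]) - r%:R).
  rewrite /= raddfD !raddfB /= !Re_natr; split.
    by have := ler0n R n; rewrite -[r.+2%:R]natr1 -[r.+1%:R]natr1; lra.
  rewrite (_ : _ - 1 = complex.Re s - r.+1%:R) //.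
  by rewrite -[r.+1%:R]natr1; lra.
have H2 n : tails_ge [seq complex.Re x | x <- - n%:R :: u]
    (complex.Re (s + n%:R) - r%:R).
  rewrite /= raddfD !raddfN /= !Re_natr; split.
    by have := ler0n R n; move: h2; rewrite -[r.+1%:R]natr1; lra.
  rewrite (_ : _ - 1 = complex.Re s - r.+1%:R) //.
  by rewrite -[r.+1%:R]natr1; lra.
have HE n : ccvg (fun L => \sum_(l < L) \sum_(k < l)
      G_kernel r u s l k * ((k.+1%:R / l.+1%:R) ^+ n)%:C%C) (E n).
  have [_ c1] := IH _ _ (H1 n); have [_ c2] := IH _ _ (H2 n).
  have := ccvgB c1 c2; rewrite !rev_cons; congr ccvg; apply: funext => L.
  by rewrite -sumrB; apply: eq_bigr => l _; rewrite G_kernelE.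
have [z [Ez Az]] := G_kernel_series_cvg h HE.
have Ez' : ccvg (series E) z by rewrite seriesEord.
have -> : G r.+2 (rev u) s = z by exact: (ccvg_lim Ez').
split=> //; split.
  move=> n; rewrite -!rev_cons; split; first by case: (IH _ _ (H1 n)).
  by case: (IH _ _ (H2 n)).
by apply/cvg_ex; exists z; exact: ccvg_cvg Ez'.
Qed.

End MainStep.

Theorem theorem1p3 (R : realType) (b : nat) (hb : (1 <= b)%N) :
  exists C : R, forall s : R[i], C < complex.Re s ->
    G_defined b [::] s /\ G b [::] s = mzeta [:: s].
Proof.
(* With [b = r.+1], this bound makes the effective exponent [Re s - r] exceed 2, as [tails_ge] asks
   for an empty list. *)
case: b hb => // r _; exists r.+2%:R => s hs.
have h1 : tails_ge [seq complex.Re x | x <- [::]] (complex.Re s - r%:R).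
  by split=> //; move: hs; rewrite -[r.+2%:R]natr1 -[r.+1%:R]natr1; lra.
have h0 : tails_ge [seq complex.Re x | x <- [::]] (complex.Re s - 0%:R).
  by split=> //; have := ler0n R r; case: h1; lra.
have [Gd Gc] := G_closed_form h1; split=> //.
(* At level 1, G is zeta itself, so the case r = 0 expands zeta(s); the two expansions agree
   termwise because l^{r-s} l^{-r} = l^{-s}. *)
have [_ G0] := G_closed_form h0.
apply: ccvg_unique Gc _; move: G0; congr ccvg; apply: funext => L.
apply: eq_bigr => l _; rewrite /= expr0 invr1 mulr1 subr0.
have {1}-> : s = (s - r%:R) + r%:R by rewrite subrK.
by rewrite natpowND natpowN_nat.
Qed.
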